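(* There is a constant $c$ such that for infinitely many integers $n$, there is a 2-degenerate graph $G$ that has a path of order $n$ and no induced path of order more than $c(\log\log n)^2$.
   Context: Graphs are finite, simple and undirected. Logarithms are binary. The order of a path is its number of vertices. For an integer $k$, a graph $G$ is $k$-degenerate if every (non-empty) subgraph of $G$ has a vertex of degree at most $k$. ''$G$ has a path of order $n$'' means that $G$ contains, as a (not necessarily induced) subgraph, a path on $n$ vertices; an induced path is a path that is an induced subgraph. *)

(* Defs.v *)
From mathcomp Require Import all_boot all_order all_algebra.
From mathcomp Require Import reals exp.

Set Implicit Arguments.
Unset Strict Implicit.
Unset Printing Implicit Defensive.

Import GRing.Theory Num.Theory.

Record sgraph := SGraph {
  vertex :> finType;
  adj : rel vertex;
  adj_sym : symmetric adj;
  adj_irrefl : irreflexive adj }.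

(* Not necessarily induced: both vertices and edges may be dropped. *)
Record subgraph (G : sgraph) := Subgraph {
  sub_vertices : {set G};
  sub_adj : rel G;
  sub_adj_sym : symmetric sub_adj;
  sub_adjP : forall x y : G, sub_adj x y ->
    [/\ x \in sub_vertices, y \in sub_vertices & adj x y] }.

Definition sub_degree (G : sgraph) (H : subgraph G) (x : G) : nat :=
  #|[set y : G | sub_adj H x y]|.

Definition degenerate (k : nat) (G : sgraph) : Prop :=
  forall H : subgraph G, sub_vertices H != set0 ->
    exists2 x : G, x \in sub_vertices H & sub_degree H x <= k.

(* A path is given by the sequence of its vertices, so its order is the size
   of the sequence. *)
Definition is_path (G : sgraph) (p : seq G) : bool :=
  uniq p && sorted (@adj G) p.

Definition consecutive (G : sgraph) (p : seq G) (x y : G) : bool :=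
  (index y p == (index x p).+1) || (index x p == (index y p).+1).

(* Every edge of G between two vertices of the path is an edge of the path. *)
Definition is_induced_path (G : sgraph) (p : seq G) : Prop :=
  is_path p /\ {in p &, forall x y : G, adj x y -> consecutive p x y}.

Definition has_path (G : sgraph) (n : nat) : Prop :=
  exists2 p : seq G, is_path p & size p = n.

(* Since ln x = 0 for x <= 0, log2 (log2 n) has its usual value for n > 1 and
   is 0 for n <= 1. *)
Definition log2 (R : realType) (x : R) : R := (ln x / ln 2)%R.

(* Main.v *)
(* Fix [k].  The vertices live at the nodes of a binary tree of depth [2 ^ k - 1].
   A node carries two adjacent hubs, one on each side, and below them a ladder of
   [2k + 2] levels with one vertex per side; connectors subdivide the edges of the
   ladder, so that a depth-first walk down the left sides and up the right sides is
   a path through more than [2 ^ 2 ^ k] vertices.  Both vertices of a level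
   are moreover joined to both hubs of one ancestor [z], the target of the level,
   chosen among the depths [z] whose dyadic block [z, z + 2 ^ i) contains the depth
   of the node; dyadic blocks are laminar and each depth lies in at most [k + 1].

   An induced path that has left a hub of [z] through a level with target [z] meets
   no other such level.  As these levels cut every node of the block of [z], what
   follows either stays inside that block, or leaves it at its bottom.  Following
   a path from its topmost vertex, the hubs visited thus belong first to
   blocks of increasing size and then to nested blocks of decreasing size.  Between
   two hubs only one ladder is traversed, hence [O(k)] hubs are visited and the
   path has order [O(k ^ 2)]. *)

Require Import Defs.
From mathcomp Require Import all_boot all_order all_algebra.
From mathcomp Require Import classical_sets cardinality reals exp.
From mathcomp Require Import zify.

Set Implicit Arguments.
Unset Strict Implicit.
Unset Printing Implicit Defensive.

(** * Dyadic intervals *)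

(* The left end of the dyadic interval of length [2 ^ i] that contains [d]. *)
Definition anc (i d : nat) : nat := d %/ 2 ^ i * 2 ^ i.

Lemma anc0 d : anc 0 d = d.
Proof. by rewrite /anc expn0 divn1 muln1. Qed.

Lemma anc_le i d : anc i d <= d.
Proof. exact: leq_divM. Qed.

Lemma dvdn_anc i d : 2 ^ i %| anc i d.
Proof. exact: dvdn_mull. Qed.

Lemma anc_lt i d : d < anc i d + 2 ^ i.
Proof. by rewrite /anc addnC -mulSn ltn_ceil // expn_gt0. Qed.

Lemma ancP i d z : 2 ^ i %| z -> z <= d -> d < z + 2 ^ i -> anc i d = z.
Proof.
case/dvdnP=> q -> le_qd lt_dq; congr (_ * _); apply/eqP.
have i_gt0 : 0 < 2 ^ i by rewrite expn_gt0.
by rewrite eqn_leq leq_divRL // le_qd andbT -ltnS ltn_divLR // mulSn addnC.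
Qed.

Lemma anc_between i d e : anc i d <= e -> e <= d -> anc i e = anc i d.
Proof.
move=> le1 le2; apply: ancP => //; first exact: dvdn_anc.
exact: leq_ltn_trans le2 (anc_lt i d).
Qed.

Lemma anc_homo i j d : i <= j -> anc j d <= anc i d.
Proof.
move=> le_ij; have /dvdnP[q def_q]: 2 ^ i %| anc j d.
  exact: dvdn_trans (dvdn_exp2l 2 le_ij) (dvdn_anc j d).
by rewrite def_q leq_pmul2r ?expn_gt0 // leq_divRL ?expn_gt0 // -def_q anc_le.
Qed.

Lemma anc_anc i j d : i <= j -> anc j (anc i d) = anc j d.
Proof.
by move=> le_ij; apply: anc_between; [exact: anc_homo | exact: anc_le].
Qed.

Lemma anc_succ i d : anc i d.+1 <= d -> anc i d.+1 = anc i d.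
Proof. by move=> le_d; rewrite (@anc_between i d.+1 d). Qed.

(** * Laminarity of the dyadic blocks, and the targets of the levels *)

Section Laminar.

Variable k : nat.

Definition block (z w : nat) : Prop := exists2 i, i <= k & anc i w = z.

Lemma block_le z w : block z w -> z <= w.
Proof. by case=> i _ <-; exact: anc_le. Qed.

Lemma block_between z y w : block z w -> z <= y -> y <= w -> block z y.
Proof. by case=> i le_ik <- le1 le2; exists i; rewrite // (anc_between le1). Qed.

Lemma block_trans z y w : block z y -> block y w -> block z w.
Proof.
case=> i le_ik def_z [j le_jk def_y]; case: (leqP j i) => [le_ji | lt_ij].
  by exists i; rewrite // -(anc_anc w le_ji) def_y.
exists j; rewrite // def_y -def_z (@ancP _ _ y) ?leqnn //; last first.
  by rewrite -addn1 leq_add2l expn_gt0.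
by rewrite -def_y (dvdn_trans (dvdn_exp2l 2 (ltnW lt_ij))) // dvdn_anc.
Qed.

Lemma block_outer z y d : block z d -> block y d.+1 -> z < y -> y <= d ->
  block z d.+1.
Proof.
move=> bz by1 lt_zy le_yd; apply: block_trans by1.
exact: block_between bz (ltnW lt_zy) le_yd.
Qed.

(** A point inside a block of length [2 ^ i] and distinct from its start is no multiple of [2 ^ i],
    while the start is. So the 2-adic valuation drops along nested blocks, which bounds the
    shrinking phase of a path. *)
Lemma block_lognS z w : 0 < z -> block z w -> z < w -> logn 2 w < logn 2 z.
Proof.
move=> z_gt0 [i le_ik def_z] lt_zw.
have le_i: i <= logn 2 z by rewrite -pfactor_dvdn // -def_z dvdn_anc.
apply: leq_trans le_i; rewrite ltnNge -pfactor_dvdn ?(leq_trans _ lt_zw) //.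
apply/negP=> dv; move: lt_zw; rewrite -def_z (@ancP _ _ w) ?ltnn //.
by rewrite -addn1 leq_add2l expn_gt0.
Qed.

(** The longest block starting at [z] has length [2 ^ s], with [s] the valuation of [z]. If it ends
    at [w], then [w.+1 = z + 2 ^ s] is a sum of two odd multiples of [2 ^ s], so the valuation
    grows. This bounds the growing phase. *)
Lemma block_logn_next z w : 0 < z -> block z w -> ~ block z w.+1 ->
  w.+1 < 2 ^ k -> logn 2 z < logn 2 w.+1.
Proof.
move=> z_gt0 [i le_ik def_z] nbl lt_w; set s := logn 2 z.
have le_is: i <= s by rewrite -pfactor_dvdn // -def_z dvdn_anc.
have dv_s: 2 ^ s %| z by rewrite pfactor_dvdn.
have le_zw: z <= w by rewrite -def_z anc_le.
have lt_ws: w < z + 2 ^ s.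
  by apply: (leq_trans (anc_lt i w)); rewrite def_z leq_add2l leq_pexp2l.
(* The bound on [w] makes [2 ^ s] one of the lengths that [block] admits. *)
have lt_sk: s < k.
  rewrite -(@ltn_exp2l 2) //; apply: leq_ltn_trans (dvdn_leq z_gt0 dv_s) _.
  by apply: leq_ltn_trans le_zw _; apply: ltnW.
have def_w: w.+1 = z + 2 ^ s.
  apply/eqP; rewrite eqn_leq lt_ws leqNgt; apply/negP=> lt_w1.
  by apply: nbl; exists s; [exact: ltnW | apply: ancP => //; exact: leqW].
rewrite -pfactor_dvdn // def_w.
have [q def_q] := dvdnP dv_s; rewrite def_q -mulSnr expnS dvdn_pmul2r ?expn_gt0 //.
rewrite dvdn2 /= negbK; apply/negPn/negP=> ev_q.
have: 2 ^ s.+1 %| z by rewrite def_q expnS dvdn_pmul2r ?expn_gt0 // dvdn2.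
by rewrite pfactor_dvdn // ltnn.
Qed.

(* The target of level [j] at depth [d], for [1 <= j <= 2k+2]: as [j] grows, the
   targets run through the blocks of [d], from small to large, and back through
   those that contain both [d] and [d.+1].  The value [d.+1] stands for no target.
   Hence a path leaving a level with target [z], upwards or down to a child, has to
   cross all the smaller blocks it stays in; and below a level whose target has its
   block ending at [d] all larger blocks are crossed. *)
Definition tgt (d j : nat) : nat :=
  if j <= k.+1 then anc j.-1 d else anc (k.*2.+2 - j) d.+1.

Lemma tgt1 d : tgt d 1 = d.
Proof. by rewrite /tgt /= anc0. Qed.

Lemma tgt_block d j : tgt d j <= d -> 0 < j -> block (tgt d j) d.
Proof.
rewrite /tgt; case: (leqP j k.+1) => [le_j _ j_gt0 | lt_j le_d _].
  by exists j.-1 => //; lia.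
by exists (k.*2.+2 - j); [lia | rewrite anc_succ].
Qed.

Lemma tgt_block_succ d j : k.+1 < j -> tgt d j <= d -> block (tgt d j) d.+1.
Proof.
by rewrite /tgt; case: (leqP j k.+1) => // lt_j _ _; exists (k.*2.+2 - j) => //; lia.
Qed.

Lemma tgt_desc d i j : 0 < i -> i <= j -> j <= k.+1 -> tgt d j <= tgt d i.
Proof.
move=> i_gt0 le_ij le_j; rewrite /tgt le_j (leq_trans le_ij) //.
by apply: anc_homo; lia.
Qed.

Lemma tgt_asc d i j : k.+1 < i -> i <= j -> tgt d i <= tgt d j.
Proof.
move=> lt_i le_ij; rewrite /tgt !ifF; try lia.
by apply: anc_homo; lia.
Qed.

Lemma block_tgt_desc z d : block z d ->
  exists j, [/\ 0 < j, j <= k.+1 & tgt d j = z].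
Proof. by case=> i le_ik def_z; exists i.+1; split=> //; rewrite /tgt (_ : i.+1 <= k.+1). Qed.

Lemma block_tgt_asc z d : block z d.+1 ->
  exists j, [/\ k.+1 < j, j <= k.*2.+2 & tgt d j = z].
Proof.
case=> i le_ik def_z; exists (k.*2.+2 - i); rewrite /tgt; split; try lia.
by rewrite ifF ?subKn //; lia.
Qed.

Lemma tgt_above d i j : 0 < i -> i < j -> tgt d i < tgt d j -> k.+1 < j.
Proof.
move=> i_gt0 lt_ij lt_t; rewrite ltnNge; apply/negP=> le_j.
by move: lt_t; rewrite ltnNge tgt_desc // ltnW.
Qed.

Lemma tgt_cross_down d j z : 0 < j -> tgt d j < z -> z <= d ->
  block z d.+1 -> exists j', [/\ j < j', j' <= k.*2.+2 & tgt d j' = z].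
Proof.
move=> j_gt0 lt_jz le_zd /block_tgt_asc[j' [lt_j' le_j' def_z]].
exists j'; split=> //; rewrite ltnNge; apply/negP=> le.
by move: lt_jz; rewrite -def_z ltnNge tgt_asc.
Qed.

(** A level whose block ends at depth [d] lies in the first half, where the targets recede; the
    larger blocks come after it. *)
Lemma tgt_cross_bottom d j z : 0 < j -> tgt d j <= d -> ~ block (tgt d j) d.+1 ->
  block z d -> z < tgt d j -> exists j', [/\ j < j', j' <= k.*2.+2 & tgt d j' = z].
Proof.
move=> j_gt0 le_d nbl /block_tgt_desc[j' [j'_gt0 le_j' def_z]] lt_z.
exists j'; split=> //; last by lia.
rewrite ltnNge; apply/negP=> le.
have le_j: j <= k.+1.
  by rewrite leqNgt; apply/negP=> lt_j; apply/nbl/tgt_block_succ.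
by move: lt_z; rewrite -def_z ltnNge tgt_desc.
Qed.

(** A path along the ladder from level [j0] to level [j1] crosses every block between the two
    targets. If [j1] is in the first half, monotonicity there suffices. Otherwise laminarity puts
    [d.+1] in the block of [z], and the level is found in the second half. *)
Lemma tgt_cross_up d j0 j1 z : 0 < j0 -> 0 < j1 -> block z d ->
  tgt d j0 < z -> z < tgt d j1 -> tgt d j1 <= d ->
  exists j, [/\ tgt d j = z, minn j0 j1 < j & j < maxn j0 j1].
Proof.
move=> j0_gt0 j1_gt0 bz lt0 lt1 le1.
case: (leqP j1 k.+1) => [le_j1 | lt_j1].
  have [j [j_gt0 le_j def_z]] := block_tgt_desc bz.
  have lt_j1j: j1 < j.
    rewrite ltnNge; apply/negP=> le; move: lt1.
    by rewrite -def_z ltnNge tgt_desc.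
  have lt_jj0: j < j0.
    rewrite ltnNge; apply/negP=> le; move: lt0.
    by rewrite -def_z ltnNge tgt_desc.
  by exists j; split=> //; lia.
have bz1: block z d.+1.
  by apply: block_outer bz (tgt_block_succ lt_j1 le1) lt1 le1.
have [j [lt_j le_j def_z]] := block_tgt_asc bz1.
have lt_jj1: j < j1.
  by rewrite ltnNge; apply/negP=> le; move: lt1; rewrite -def_z ltnNge tgt_asc.
have lt_j0j: j0 < j.
  by rewrite ltnNge; apply/negP=> le; move: lt0; rewrite -def_z ltnNge tgt_asc.
by exists j; split=> //; lia.
Qed.

End Laminar.

(** * The graph on all finite nodes, and its adjacency *)

Section Construction.

Variable k : nat.

(* [(t, h, s)] is the vertex of the tree node [t] at distance [h] below its hub on
   side [s]: a hub for [h = 0], level [j] for [h = 2j], a connector for [h] odd,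
   and for [h = top.+1] the connector between the two children of [t]. *)
Definition vert : Type := (seq bool * nat * bool)%type.
Definition node (v : vert) : seq bool := v.1.1.
Definition height (v : vert) : nat := v.1.2.
Definition top : nat := (k.*2.+2).*2.+1.

Definition level_of (v : vert) (z : seq bool) : bool :=
  [&& 0 < height v < top, ~~ odd (height v),
      tgt k (size (node v)) (height v)./2 <= size (node v)
    & take (tgt k (size (node v)) (height v)./2) (node v) == z].

(* The neighbours of smaller [rank]. *)
Definition down (v : vert) : seq vert :=
  let: (t, h, s) := v in
  if h == 0 then (if s then [:: (t, 0, false)] else [::])
  else if h < top then
    if odd h then [:: (t, h.-1, s); (t, h.+1, s)]
    else let m := tgt k (size t) h./2 in
      if m <= size t then [:: (take m t, 0, false); (take m t, 0, true)]
      else [::]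
  else if h == top then [:: (t, h.-1, s); (rcons t s, 0, s)]
  else [:: (rcons t false, 0, true); (rcons t true, 0, false)].

Definition edge : rel vert := fun x y => (y \in down x) || (x \in down y).

(** Hubs, levels and connectors in this order; together with [size_down] it gives 2-degeneracy. *)
Definition rank (v : vert) : nat :=
  if height v == 0 then nat_of_bool v.2
  else if odd (height v) || (top < height v) then 3 else 2.

Lemma odd_top : odd top.
Proof. by rewrite /top /= odd_double. Qed.

Lemma size_down v : size (down v) <= 2.
Proof. by case: v => [[t h] s] /=; repeat case: ifP => _. Qed.

Lemma rank_down x y : y \in down x -> rank y < rank x.
Proof.
case: x => [[t h] s]; rewrite /rank {2 3 4}/height /=.
case: (posnP h) => [_ | h_gt0]; first by case: s; rewrite ?inE // => /eqP->.
have := odd_top; case: (ltngtP h top) => [lt_h | lt_h | def_h] odd_N.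
- case: ifP => [odd_h | odd_h].
    by rewrite !inE => /orP[] /eqP->; rewrite /height /=; repeat case: ifP => //=; lia.
  by case: ifP => // _; rewrite !inE => /orP[] /eqP->.
- by rewrite orbT !inE => /orP[] /eqP->.
rewrite -def_h in odd_N *; rewrite odd_N !inE.
by case/orP=> /eqP->; rewrite /height /=; repeat case: ifP => //=; lia.
Qed.

Lemma edge_sym : symmetric edge.
Proof. by move=> x y; rewrite /edge orbC. Qed.

Lemma edge_irrefl : irreflexive edge.
Proof. by move=> x; apply/negP=> /orP[] /rank_down; rewrite ltnn. Qed.

Lemma level_hubE t h s z c : level_of (t, h, s) z -> (z, 0, c) \in down (t, h, s).
Proof.
case/and4P=> /= /andP[h_gt0 lt_h] ev_h le_m /eqP <-.
by rewrite gtn_eqF // lt_h (negbTE ev_h) le_m; case: c; rewrite !inE eqxx ?orbT.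
Qed.

Lemma edge_level v z c : level_of v z -> edge v (z, 0, c).
Proof. by case: v => [[t h] s] /level_hubE; rewrite /edge => ->. Qed.

Lemma edge_partner z : edge (z, 0, true) (z, 0, false).
Proof. by rewrite /edge /= inE eqxx. Qed.

Lemma edge_hub_hub z c z' c' : edge (z, 0, c) (z', 0, c') -> z = z'.
Proof.
by rewrite /edge /=; case/orP; case: c; case: c'; rewrite // inE => /eqP[].
Qed.

Lemma edge_line_line t h s t' h' s' : 0 < h -> 0 < h' ->
  edge (t, h, s) (t', h', s') ->
  [/\ t = t', s = s', h <= top, h' <= top & (h' == h.+1) || (h == h'.+1)].
Proof.
have dn_line t1 h1 s1 t2 h2 s2 : 0 < h1 -> 0 < h2 ->
    (t1, h1, s1) \in down (t2, h2, s2) ->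
  [/\ t1 = t2, s1 = s2, h1 <= top, h2 <= top & (h1 == h2.+1) || (h2 == h1.+1)].
  move=> h1_gt0 h2_gt0 /=; rewrite gtn_eqF //.
  case: (ltngtP h2 top) => [lt_h | lt_h | def_h2].
  - case: ifP => [odd_h | odd_h].
      by rewrite !inE => /orP[] /eqP[-> def_h ->]; split=> //; lia.
    by case: ifP => // _; rewrite !inE => /orP[] /eqP[_ h0 _]; lia.
  - by rewrite !inE => /orP[] /eqP[_ h0 _]; lia.
  by rewrite !inE => /orP[] /eqP[-> def_h ->]; split=> //; lia.
move=> h_gt0 h'_gt0; case/orP=> /dn_line[] // -> -> le_h le_h' ?; split=> //.
by rewrite orbC.
Qed.

Inductive hub_line_spec z c (v : vert) : Prop :=
  | HubFirst of node v = z & height v = 1 & v.2 = c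
  | HubChild of z = rcons (node v) c & height v = top & v.2 = c
  | HubSibling of z = rcons (node v) (~~ c) & top < height v
  | HubLevel of level_of v z.

Lemma edge_hub_line z c v : 0 < height v -> edge (z, 0, c) v ->
  hub_line_spec z c v.
Proof.
case: v => [[t h] s]; rewrite /height /= => h_gt0; case/orP.
  by rewrite /=; case: c => //; rewrite inE => /eqP[_ h0 _]; lia.
rewrite /= gtn_eqF //; case: (ltngtP h top) => [lt_h | lt_h | def_h].
- case: ifP => [odd_h | odd_h].
    rewrite !inE => /orP[] /eqP[-> def_h ->]; last by lia.
    by apply: HubFirst => //=; rewrite /height /=; lia.
  case: ifP => // le_m; rewrite !inE => in_d; apply: HubLevel.
  rewrite /level_of /node /height /= h_gt0 lt_h odd_h le_m /=.
  by case/orP: in_d => /eqP[-> _].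
- rewrite !inE => /orP[] /eqP[-> ->]; exact: HubSibling.
rewrite !inE => /orP[] /eqP[]; first by move: def_h; rewrite /top; lia.
by move=> -> ->; apply: HubChild.
Qed.


(** * Prefixes, walks and induced paths *)

Lemma prefix_comparable (T : eqType) (a b t : seq T) :
  prefix a t -> prefix b t -> size a <= size b -> prefix a b.
Proof.
rewrite !prefixE => /eqP def_a /eqP def_b le_ab.
by rewrite -def_b take_takel // def_a.
Qed.

Lemma prefix_size_eq (T : eqType) (a b : seq T) :
  prefix a b -> size b <= size a -> a = b.
Proof. by rewrite prefixE => /eqP def_a le; rewrite -def_a take_oversize. Qed.

Lemma prefix_rconsW (T : eqType) (a t : seq T) x :
  prefix a (rcons t x) -> a != rcons t x -> prefix a t.
Proof.
move=> pre neq; apply: (prefix_comparable pre (prefix_rcons t x)).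
rewrite -ltnS -(size_rcons t x) ltnNge; apply/negP=> le.
by rewrite (prefix_size_eq pre le) eqxx in neq.
Qed.

Lemma split_all (T : eqType) (a : pred T) s : exists s1 s2,
  [/\ s = s1 ++ s2, all a s1 & s2 = [::] \/ exists x s3, s2 = x :: s3 /\ ~~ a x].
Proof.
elim: s => [|x s [s1 [s2 [-> a1 a2]]]]; first by exists [::], [::]; split=> //; left.
case ax: (a x); first by exists (x :: s1), s2; split=> //=; rewrite ax.
by exists [::], (x :: s1 ++ s2); split=> //; right; exists x, (s1 ++ s2); rewrite ax.
Qed.

Lemma path_stay (T : eqType) (e : rel T) (a : pred T) x s :
  path e x s -> a x ->
  (forall u v, u \in x :: s -> v \in s -> a u -> e u v -> a v) -> all a (x :: s).
Proof.
elim: s x => [|y s IHs] x /=; first by move=> _ ->.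
case/andP=> exy pys ax stay; rewrite ax /=.
have ay: a y by apply: stay ax exy; rewrite !inE eqxx ?orbT.
apply: IHs pys ay _ => u v u_s v_s; apply: stay.
  by rewrite inE u_s orbT.
by rewrite inE v_s orbT.
Qed.

(** A discrete intermediate value theorem, applied to heights: a path along a ladder meets every
    level between its ends. *)
Lemma path_ivt (T : eqType) (f : T -> nat) (e : rel T) x s m :
  (forall u v, u \in x :: s -> v \in x :: s -> e u v ->
     (f v == (f u).+1) || (f u == (f v).+1)) ->
  path e x s -> minn (f x) (f (last x s)) < m < maxn (f x) (f (last x s)) ->
  exists2 u, u \in x :: s & f u = m.
Proof.
elim: s x => [|y s IHs] x /= step; first by lia.
case/andP=> exy pys m_between.
have := step x y; rewrite !inE !eqxx orbT => /(_ isT isT exy) step_xy.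
case: (eqVneq (f y) m) => [<- | y_neq_m].
  by exists y; rewrite // !inE eqxx orbT.
have [u v u_s v_s | | u u_s fu] := IHs y _ pys; last by exists u; rewrite // inE u_s orbT.
  by apply: step; rewrite inE ?u_s ?v_s orbT.
by lia.
Qed.

Lemma edge_comparable u v : edge u v ->
  prefix (node u) (node v) \/ prefix (node v) (node u).
Proof.
have hub_case t c w : 0 < height w -> edge (t, 0, c) w ->
    prefix t (node w) \/ prefix (node w) t.
  move=> w_gt0 /(edge_hub_line w_gt0)[<- _ _ | -> _ _ | -> _ | /and4P[_ _ _ /eqP<-]].
  - by left; exact: prefix_refl.
  - by right; exact: prefix_rcons.
  - by right; exact: prefix_rcons.
  by left; exact: prefix_take.
case: u v => [[t h] s] [[t' h'] s'] e_uv.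
case: (posnP h) e_uv => [-> | h_gt0] e_uv.
  case: (posnP h') e_uv => [-> | h'_gt0] e_uv; last exact: hub_case e_uv.
  by rewrite /node (edge_hub_hub e_uv); left; exact: prefix_refl.
case: (posnP h') e_uv => [-> | h'_gt0] e_uv.
  by rewrite edge_sym in e_uv; case: (hub_case t' s' (t, h, s) h_gt0 e_uv); [right | left].
by case: (edge_line_line h_gt0 h'_gt0 e_uv) => -> *; left; exact: prefix_refl.
Qed.

(** Chords are excluded cut by cut: an edge across a cut of the sequence joins the two vertices at
    the cut. This form passes to suffixes and reversals and applies directly wherever the path is
    split. *)
Definition induced (P : seq vert) : Prop :=
  [/\ uniq P, sorted edge P
    & forall A B x y, P = A ++ B -> x \in A -> y \in B -> edge x y ->
        x = last x A /\ y = head y B].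

Lemma induced_suffix A B : induced (A ++ B) -> induced B.
Proof.
case; rewrite cat_uniq => /and3P[_ _ uB] sAB cut; split=> //.
  by have [] := cat_sorted2 sAB.
move=> C D x y def_B x_C y_D /(cut (A ++ C) D x y) [] //.
- by rewrite def_B catA.
- by rewrite mem_cat x_C orbT.
by move=> def_x def_y; split=> //; rewrite {1}def_x; case: (C) x_C => // a C' _; rewrite last_cat.
Qed.

Lemma induced_rev P : induced P -> induced (rev P).
Proof.
case=> uP sP cut; split; first by rewrite rev_uniq.
  by rewrite rev_sorted; apply: sub_sorted sP => x y; rewrite edge_sym.
move=> A B x y def_P x_A y_B e_xy.
have def_P' : P = rev B ++ rev A by rewrite -rev_cat -def_P revK.
rewrite edge_sym in e_xy; have := cut _ _ y x def_P'; rewrite !mem_rev.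
case=> // def_y def_x; split.
  by case/lastP: A def_x {def_P def_P' x_A} => // A a; rewrite rev_rcons last_rcons.
by case: B def_y {def_P def_P' y_B} => // b B; rewrite rev_cons last_rcons.
Qed.

Definition hub_of (z : seq bool) (v : vert) : bool :=
  (node v == z) && (height v == 0).
Definition below (p : seq bool) (v : vert) : bool :=
  prefix p (node v) && ~~ hub_of p v.
Definition line_of (p : seq bool) (v : vert) : bool :=
  (node v == p) && (0 < height v).
(** The bounded region where a path below [p] moves before it settles in the subtree of a child. *)
Definition near (p : seq bool) (v : vert) : bool :=
  line_of p v || (hub_of (rcons p false) v || hub_of (rcons p true) v).
Definition valid (v : vert) : bool :=
  (size (node v) < 2 ^ k) && (height v <= top.+1).
(** Heights [1] to [top.+1] on two sides, and the four hubs of the children. *)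
Definition width : nat := (top.+1).*2 + 4.

Lemma hub_ofP z v : hub_of z v -> exists c, v = (z, 0, c).
Proof. by case: v => [[t h] s] /andP[/eqP/= <- /eqP/= <-]; exists s. Qed.

Lemma size_near p P : uniq P -> all valid P -> all (near p) P -> size P <= width.
Proof.
move=> uP /allP vP /allP nP.
pose W := [seq (p, h, s) | h <- iota 1 top.+1, s <- [:: false; true]] ++
  [:: (rcons p false, 0, false); (rcons p false, 0, true);
      (rcons p true, 0, false); (rcons p true, 0, true)].
have ->: width = size W by rewrite size_cat size_allpairs size_iota muln2.
apply: uniq_leq_size => // v v_P; rewrite mem_cat; apply/orP.
case/orP: (nP v v_P) => [/andP[/eqP def_p h_gt0] | hub_v].
  left; apply/allpairsP; exists (height v, v.2); rewrite mem_iota; split=> /=.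
  - by rewrite h_gt0 ltnS; case/andP: (vP v v_P).
  - by rewrite !inE; case: (v.2).
  by rewrite -def_p; case: (v) => [[]].
right; case/orP: hub_v => /hub_ofP[c ->]; case: c; rewrite !inE eqxx ?orbT //.
Qed.

Lemma rcons_neq (p : seq bool) b : (rcons p b == p) = false.
Proof. by apply/eqP=> /(congr1 size)/eqP; rewrite size_rcons eqn_leq ltnn. Qed.

Lemma hub_near_below p b v : hub_of (rcons p b) v -> near p v && below p v.
Proof.
case/hub_ofP=> c ->; rewrite /near /below /hub_of /line_of /node /height /=.
by rewrite prefix_rcons !rcons_neq !andbT; case: b; rewrite eqxx ?orbT.
Qed.

Lemma level_ofP v z : level_of v z -> exists j,
  [/\ 0 < j, j <= k.*2.+2, height v = j.*2 & tgt k (size (node v)) j = size z]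
  /\ prefix z (node v).
Proof.
case/and4P=> /andP[h_gt0 lt_h] ev_h le_m /eqP def_z.
have def_h: height v = (height v)./2.*2 by rewrite even_halfK.
exists (height v)./2; rewrite -def_z prefix_take size_takel //.
by split=> //; move: lt_h h_gt0; rewrite /top; split=> //; lia.
Qed.

Lemma level_of_tgt t j s z : 0 < j -> j <= k.*2.+2 -> prefix z t ->
  tgt k (size t) j = size z -> level_of (t, j.*2, s) z.
Proof.
move=> j_gt0 le_j pre_zt def_j; rewrite /level_of /node /height /= doubleK def_j.
rewrite odd_double double_gt0 j_gt0 size_prefix //= -prefixE pre_zt andbT.
by rewrite /top ltnS leq_double.
Qed.

(** * Confinement of a path to a subtree *)

(* The level [l0] of [p] seals the subtree of [p] from above; the only other way
   out is to jump to a hub between [z] and [p], which [excl] forbids. *)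
Lemma path_below z p l0 v C :
    0 < l0 -> l0 <= k.*2.+2 -> tgt k (size p) l0 = size z -> prefix z p ->
    path edge v C -> prefix p (node v) -> node v != p ->
    all (below z) (v :: C) -> {in v :: C, forall u, ~~ level_of u z} ->
    (forall y c, (y, 0, c) \in v :: C -> prefix y p -> size z < size y ->
       ~ block k (size y) (size p).+1) ->
  all (below p) (v :: C).
Proof.
move=> l0_gt0 le_l0 tgt_l0 pre_zp pathC pre_v neq_v /allP zC nlev excl.
pose proper t := prefix p t && (t != p).
(* The region that the path never leaves: the nodes strictly below [p], and the ladder of [p] beyond
   level [l0]. *)
pose a u := proper (node u) || ((node u == p) && (l0.*2 < height u)).
have lt_top: l0.*2 < top by rewrite /top; lia.
have aI u : prefix p (node u) -> (node u = p -> l0.*2 < height u) -> a u.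
  move=> pre_u; rewrite /a /proper pre_u /=; case: eqP => // -> lt_u.
  exact: lt_u.
have a_pre u : a u -> prefix p (node u).
  by case/orP=> [/andP[] | /andP[/eqP-> _]] //; exact: prefix_refl.
suffices /allP aC: all a (v :: C).
  apply/allP=> u /aC; rewrite /below /hub_of; case/orP=> /andP[].
    by move=> -> /negbTE->.
  move=> /eqP-> lt_u; rewrite prefix_refl gtn_eqF ?andbF //.
  exact: leq_ltn_trans lt_u.
apply: path_stay pathC _ _; first by rewrite /a /proper pre_v neq_v.
have down_a t c u : 0 < height u -> proper t -> edge (t, 0, c) u -> a u.
  move=> u_gt0 /andP[pre_pt neq_tp].
  case/(edge_hub_line u_gt0) => [def_t _ _ | def_t h_u _ | def_t h_u | lev].
  - by apply: aI; rewrite def_t // => eq_tp; rewrite eq_tp eqxx in neq_tp.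
  - by apply: aI; rewrite ?h_u // (@prefix_rconsW _ _ _ c) -?def_t // eq_sym.
  - apply: aI => [|_]; last exact: ltn_trans lt_top h_u.
    by rewrite (@prefix_rconsW _ _ _ (~~ c)) -?def_t // eq_sym.
  have [j [_ pre_tu]] := level_ofP lev.
  apply: aI => [|eq_up]; first exact: prefix_trans pre_pt pre_tu.
  rewrite eq_up in pre_tu; case/eqP: neq_tp.
  exact: prefix_size_eq pre_tu (size_prefix pre_pt).
move=> [[t h] s] [[t' h'] s'] u_C v_C a_u e_uv.
case: (posnP h') v_C e_uv => [-> | h'_gt0] v_C e_uv; last first.
  case: (posnP h) u_C a_u e_uv => [-> | h_gt0] u_C a_u e_uv.
    by case/orP: a_u => [pr_t | /andP[_]] //; apply: down_a e_uv.
  have [eq_t _ _ _ step] := edge_line_line h_gt0 h'_gt0 e_uv.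
  apply: aI; first by rewrite /node /= -eq_t; exact: a_pre a_u.
  rewrite /node /height /= => eq_t'p.
  have lt_h: l0.*2 < h.
    by case/orP: a_u => /andP[]; rewrite /node /= eq_t eq_t'p // eqxx.
  rewrite ltn_neqAle; apply/andP; split; last by lia.
  (* A ladder step out of the region would land on level [l0], whose target is [z]. *)
  apply/eqP=> def_h'; have /negP[]: ~~ level_of (t', h', s') z by apply: nlev; rewrite inE v_C orbT.
  by rewrite -def_h' eq_t'p; apply: level_of_tgt.
have below_v: below z (t', 0, s') by apply: zC; rewrite inE v_C orbT.
suffices pr_t': proper t' by rewrite /a /node /= pr_t'.
case: (posnP h) u_C a_u e_uv => [-> | h_gt0] u_C a_u e_uv.
  rewrite -(edge_hub_hub e_uv); case/orP: a_u => // /andP[_].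
  by rewrite /height.
have pre_t: prefix p t by apply: a_pre a_u.
have proper_rcons b : proper (rcons t b).
  rewrite /proper (prefix_trans pre_t (prefix_rcons _ _)) /=.
  by apply/eqP=> eq_tp; move: (size_prefix pre_t); rewrite -eq_tp size_rcons ltnn.
rewrite edge_sym in e_uv; case/edge_hub_line: e_uv => //.
- rewrite /node /height /= => <- def_h _; case/orP: a_u => // /andP[_].
  by rewrite /height /= def_h; lia.
- by rewrite /node /= => -> _ _.
- by rewrite /node /= => -> _.
case/level_ofP=> j [[j_gt0 le_j]]; rewrite /height /node /= => def_h def_j pre_t't.
have lt_zt': size z < size t'.
  case/andP: below_v; rewrite /hub_of /node /= andbT => pre_zt'.
  rewrite ltnNge; apply: contra => le; apply/eqP.
  by apply/esym/prefix_size_eq.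
(* A jump to a hub no deeper than [p] would be to a block that contains the depth just below [p],
   against [excl]. *)
case: (leqP (size t') (size p)) => [le_t'p | lt_pt'].
  have pre_t'p: prefix t' p by apply: prefix_comparable pre_t't pre_t le_t'p.
  case: (excl t' s') => //; first by rewrite inE v_C orbT.
  (* On [p] itself, a level beyond [l0] with a target deeper than [z] lies in the second half, so
     its block contains the next depth. *)
  case: (eqVneq t p) a_u => [eq_tp | neq_tp _].
    rewrite /a /proper /node /height /= eq_tp eqxx andbF /= def_h ltn_double => lt_j.
    rewrite -def_j eq_tp; apply: tgt_block_succ; last by rewrite -eq_tp def_j size_prefix.
    by apply: (@tgt_above k (size p) l0) => //; rewrite tgt_l0 -eq_tp def_j.
  have bl_t: block k (size t') (size t).
    by rewrite -def_j; apply: tgt_block; rewrite // def_j size_prefix.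
  apply: block_between bl_t (leqW le_t'p) _.
  rewrite ltnNge; apply: contra neq_tp => le; rewrite eq_sym; apply/eqP.
  exact: prefix_size_eq.
rewrite /proper (prefix_comparable pre_t pre_t't (ltnW lt_pt')) /=.
by apply/eqP=> eq_tp; rewrite eq_tp ltnn in lt_pt'.
Qed.

(* A connector joins the hub [(z, 0, s)] to the level [(z, 2, s)], which is
   adjacent to that hub: an induced path cannot use both edges. *)
Lemma no_first_connector A z s x B : induced (A ++ (z, 1, s) :: x :: B) ->
  (z, 0, s) \in A -> all (fun v => prefix z (node v)) (x :: B) -> False.
Proof.
case=> uP sP cut z_A /= /andP[pre_x _].
have e_x: edge (z, 1, s) x by have [_ /= /andP[]] := cat_sorted2 sP.
have neq_x: x != (z, 0, s).
  apply: contraTneq uP => ->; rewrite cat_uniq negb_and; apply/orP; right.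
  by rewrite negb_and negbK orbC -implybE; apply/implyP=> _; apply/hasP;
    exists (z, 0, s); rewrite // !inE eqxx orbT.
case: x => [[t h] c] in pre_x e_x neq_x cut uP sP *.
case: (posnP h) => [h0 | h_gt0].
  rewrite h0 edge_sym in e_x.
  case: (edge_hub_line (isT : 0 < height (z, 1, s)) e_x)
    => [def_z _ def_s | _ h1 _ | _ h1 | lev].
  - by rewrite h0 -def_z -def_s eqxx in neq_x.
  - by move: h1; rewrite /height /top /=; lia.
  - by move: h1; rewrite /height /top /=; lia.
  by case/level_ofP: lev => j [[_ _]]; rewrite /height /=; lia.
have [def_t def_s _ _ step] := edge_line_line (isT : 0 < 1) h_gt0 e_x.
have def_h: h = 2 by lia.
have lev_x: level_of (t, h, c) z.
  by rewrite def_h -[2]/(1.*2) -def_t; apply: level_of_tgt; rewrite ?tgt1 ?prefix_refl.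
have [] // := cut A _ (z, 0, s) (t, h, c) erefl z_A; first by rewrite !inE eqxx orbT.
  by rewrite edge_sym; exact: edge_level.
by move=> _ /= [_ def_h1]; rewrite def_h1 in def_h.
Qed.

Lemma between_neqr a b m : minn a b < m < maxn a b -> m != b.
Proof. lia. Qed.

Lemma between_double a b m :
  minn a b < m -> m < maxn a b -> minn a.*2 b.*2 < m.*2 < maxn a.*2 b.*2.
Proof. lia. Qed.

Lemma between_lt a b m : a < m -> m < b -> minn a b < m < maxn a b.
Proof. lia. Qed.

(** * How an induced path moves from a hub or a ladder into the tree below *)

(* [C] is what remains of [P], which starts at a hub of [z], after its first ladder:
   it lies below [p] and starts at a hub of a child of [p].  This child is either
   in the block of [z], or just below it; in that second case [P] has crossed
   all larger blocks. *)
Definition descended (P : seq vert) z (C : seq vert) : Prop := exists p b c C',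
  [/\ C = (rcons p b, 0, c) :: C', prefix z p, all (below p) C,
      {in C, forall v, ~~ level_of v z}
    & block k (size z) (size p).+1 \/
      [/\ block k (size z) (size p), ~ block k (size z) (size p).+1
        & forall y, block k y (size p) -> y < size z ->
            exists2 v, v \in P & level_of v (take y p)]].

Lemma block_em z w : block k z w \/ ~ block k z w.
Proof.
case: (boolP (has (fun i => anc i w == z) (iota 0 k.+1))) => [/hasP[i] | /hasPn no].
  by rewrite mem_iota ltnS => /andP[_ le_i] /eqP; left; exists i.
right=> -[i le_i def_z]; have: i \in iota 0 k.+1 by rewrite mem_iota ltnS.
by move/no; rewrite def_z eqxx.
Qed.

(** The path runs along the ladder of one node [w] and then takes a hub [h]. The first hub excludes
    later levels with target [z] and its own partner; the levels traversed before [q] exclude later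
    hubs of their targets, which is what [path_below] needs. *)
Lemma descend_level z c0 x B : induced ((z, 0, c0) :: x :: B) ->
    all valid ((z, 0, c0) :: x :: B) ->
    all (fun v => prefix z (node v)) ((z, 0, c0) :: x :: B) -> level_of x z ->
  exists A C, [/\ (z, 0, c0) :: x :: B = A ++ C, size A <= width.+1
    & C = [::] \/ descended ((z, 0, c0) :: x :: B) z C].
Proof.
set y := (z, 0, c0) => indP vP preP lev_x.
have [uP sP cut] := indP.
have [j0 [[j0_gt0 le_j0 hx tgt_j0] pre_zx]] := level_ofP lev_x.
set w := node x in hx tgt_j0 pre_zx.
have hx_top: height x < top by rewrite hx /top; lia.
have [A [C [def_B line_A outC]]] := split_all (line_of w) B.
have line_xA: all (line_of w) (x :: A) by rewrite /= line_A /line_of eqxx hx double_gt0 j0_gt0.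
exists (y :: x :: A), C; rewrite def_B; split=> //.
  rewrite /= ltnS -[(size A).+1]/(size (x :: A)); apply: (@size_near w).
  - by move: uP; rewrite def_B /= !mem_cat !negb_or cat_uniq => /and3P[_ /andP[-> _] /and3P[]].
  - by move: vP; rewrite def_B /= all_cat => /and4P[_ -> -> _].
  by apply: sub_all line_xA => v; rewrite /near => ->.
case: outC => [-> | [h [C' [def_C not_line]]]]; [by left | right].
have defP : y :: x :: B = (y :: x :: A) ++ h :: C' by rewrite def_B def_C.
set q := last x A.
have q_A: q \in x :: A by exact: mem_last.
have line_q: line_of w q by apply: (allP line_xA).
have [pathA e_qh pathC]: [/\ path edge x A, edge q h & path edge h C'].
  by move: sP; rewrite def_B def_C /= cat_path /= => /and3P[_ -> /andP[-> ->]].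
have crossing u zz c : u \in x :: A -> (zz, 0, c) \in h :: C' -> level_of u zz -> u = q.
  move=> u_A z_C lev_u; have [] // := cut _ _ u _ defP _ z_C (edge_level c lev_u).
  by rewrite inE u_A orbT.
have ivt m : minn (height x) (height q) < m < maxn (height x) (height q) ->
    exists2 u, u \in x :: A & [/\ height u = m, node u = w & u != q].
  move=> m_btw; have [|u u_A hu] := path_ivt _ pathA m_btw.
    move=> u v /(allP line_xA)/andP[/eqP nu hu] /(allP line_xA)/andP[/eqP nv hv].
    case: u v nu hu nv hv => [[t1 h1] s1] [[t2 h2] s2] _ h1_gt0 _ h2_gt0 e_uv.
    by have [] := edge_line_line h1_gt0 h2_gt0 e_uv.
  exists u => //; have /andP[/eqP nu _] := allP line_xA u u_A; split=> //.
  by apply: contraNneq (between_neqr m_btw) => <-; rewrite hu.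
have level_w u j zz : node u = w -> height u = j.*2 -> 0 < j -> j <= k.*2.+2 ->
    tgt k (size w) j = size zz -> prefix zz w -> level_of u zz.
  case: u => [[t hu] s]; rewrite /node /height /= => -> -> *.
  exact: level_of_tgt.
have preB: all (fun v => prefix z (node v)) (h :: C').
  by move: preP; rewrite defP all_cat => /andP[].
have nlevC: {in h :: C', forall v, ~~ level_of v z}.
  move=> v v_C; apply/negP=> lev_v.
  have [] // := cut _ _ y v defP _ v_C; rewrite ?mem_head //.
    by rewrite edge_sym; exact: edge_level.
  move=> /= def_y _; case/andP: uP => /negP[].
  by rewrite def_B def_C -cat_cons mem_cat def_y q_A.
have belowC: all (below z) (h :: C').
  apply/allP=> v v_C; rewrite /below (allP preB) //; apply/negP=> /hub_ofP[c def_v].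
  rewrite def_v in v_C; have def_x := crossing x z c (mem_head _ _) v_C lev_x.
  have [] // := cut [:: y] (x :: B) y (z, 0, c) erefl; first exact: mem_head.
  - by rewrite def_B def_C -cat_cons mem_cat v_C orbT.
  - case: (eqVneq c c0) => [eq_c | neq_c].
      case/andP: uP => /negP[].
      by rewrite def_B def_C -cat_cons mem_cat /y -eq_c v_C orbT.
    by move: neq_c; rewrite /y; case: (c) (c0) => [] [] // _; rewrite ?edge_partner // edge_sym edge_partner.
  by move=> _ /= x_hub; move: j0_gt0; rewrite -double_gt0 -hx -x_hub.
have [c def_h]: exists c, h = (node h, 0, c).
  case: (posnP (height h)) => [h0 | h_gt0]; first by exists h.2; rewrite -h0; case: (h) => [[]].
  case: h h_gt0 not_line e_qh {def_C defP crossing pathC preB nlevC belowC} => [[t1 h1] s1] h1_gt0.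
  case: q line_q {q_A ivt} => [[t2 h2] s2] /andP[/eqP nq hq] not_line e_qh.
  have [eq_t _ _ _ _] := edge_line_line hq h1_gt0 e_qh.
  by case/negP: not_line; rewrite /line_of /node /= -eq_t h1_gt0 andbT; apply/eqP.
set t := node h in def_h.
have [nq hq_gt0] := andP line_q.
have q_pred : q = x \/ exists r, [/\ r \in x :: A, node r = w,
    (height q == (height r).+1) || (height r == (height q).+1) & height q <= top].
  rewrite /q; case/lastP: A line_xA pathA {def_B line_A defP crossing ivt q_A e_qh q line_q nq hq_gt0}.
    by left.
  move=> A q0 /=; rewrite all_rcons rcons_path last_rcons.
  move=> /and3P[lx /andP[nq0 q0_gt0] lA] /andP[_ e]; right.
  have: line_of w (last x A).
    by apply: (allP (_ : all (line_of w) (x :: A))); rewrite ?mem_last //= lx.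
  exists (last x A); rewrite -rcons_cons mem_rcons inE mem_last orbT.
  case: (last x A) (q0) H e q0_gt0 => [[t1 h1] s1] [[t2 h2] s2] /andP[/eqP nr h1_gt0] e h2_gt0.
  by have [] := edge_line_line h1_gt0 h2_gt0 e.
have h_C: (t, 0, c) \in h :: C' by rewrite -def_h mem_head.
have pre_zt: prefix z t by apply: (allP preB); exact: mem_head.
have neq_tz: t != z.
  by have := allP belowC h (mem_head _ _); rewrite def_h /below /hub_of andbT => /andP[].
have e_hq: edge (t, 0, c) q by rewrite -def_h edge_sym.
have bl_zw: block k (size z) (size w).
  by rewrite -tgt_j0; apply: tgt_block; rewrite // tgt_j0 size_prefix.
case: (edge_hub_line hq_gt0 e_hq) => [def_t hq _ | def_t hq _ | def_t hq | lev_q].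
(* A first connector is reached from level 1 of the same node, which is already adjacent to [h]. *)
- case: q_pred => [eq_qx | [r [r_A nr /orP[] /eqP hr _]]].
  + by move: hq; rewrite eq_qx hx => /(congr1 odd); rewrite odd_double.
  + by move: (allP line_xA r r_A) => /andP[_]; rewrite -ltnS -hr hq.
  have lev_r: level_of r t.
    rewrite -def_t (eqP nq); apply: (level_w r 1) => //; last exact: prefix_refl.
      by rewrite hr hq.
    exact: tgt1.
  by have /(congr1 height)/eqP := crossing r t c r_A h_C lev_r; rewrite hr hq.
(* Exit at the bottom of the ladder: all levels beyond [j0] have been crossed. *)
- rewrite (eqP nq) in def_t.
  have ivt_up j : j0 < j -> j <= k.*2.+2 -> exists2 u, u \in x :: A &
      [/\ height u = j.*2, node u = w & u != q].
    move=> lt_j le_j; apply: ivt; rewrite hq hx.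
    by apply: between_lt; rewrite ?ltn_double // /top ltnS leq_double.
  exists w, c, c, C'; split.
  + by rewrite def_C def_h def_t.
  + by [].
  + rewrite def_C; apply: (@path_below z w j0); rewrite // -?/t ?def_t ?rcons_neq ?prefix_rcons //.
    move=> zz c1 zz_C pre_zz lt_zz bl.
    have [|j [lt_j le_j def_j]] := tgt_cross_down j0_gt0 _ (size_prefix pre_zz) bl.
      by rewrite tgt_j0.
    have [u u_A [hu nu /eqP[]]] := ivt_up j lt_j le_j.
    exact: crossing zz_C (level_w u j zz nu hu (leq_trans _ lt_j) le_j def_j pre_zz).
  + by rewrite def_C.
  case: (block_em (size z) (size w).+1) => [|nbl]; [by left | right; split=> // yy bl lt_yy].
  have [|||j [lt_j le_j def_j]] := @tgt_cross_bottom k (size w) j0 yy j0_gt0 _ _ bl.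
  + by rewrite tgt_j0 size_prefix.
  + by rewrite tgt_j0.
  + by rewrite tgt_j0.
  have [u u_A [hu nu _]] := ivt_up j lt_j le_j.
  exists u; first by rewrite inE -cat_cons mem_cat u_A orbT.
  apply: (level_w u j) => //; [exact: leq_ltn_trans lt_j | | exact: prefix_take].
  by rewrite size_takel // (block_le bl).
(* The connector between siblings has no neighbour on the ladder. *)
- case: q_pred => [eq_qx | [r [_ _ _]]]; last by rewrite leqNgt hq.
  by move: hq; rewrite eq_qx ltnNge ltnW.
(* Exit by a level with target [t], inside the block of [z]. The rest lies below the parent [p] of
   [t], sealed by the level of [p] in the second half that has target [z]. *)
have [j1 [[j1_gt0 le_j1 hq tgt_j1] pre_tw]] := level_ofP lev_q.
rewrite (eqP nq) in tgt_j1 pre_tw.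
have bl_tw: block k (size t) (size w).
  by rewrite -tgt_j1; apply: tgt_block; rewrite // tgt_j1 size_prefix.
have [p [b def_t]]: exists p b, t = rcons p b.
  case/lastP: (t) pre_zt neq_tz => [|p b]; last by exists p, b.
  by rewrite prefixs0 eq_sym => ->.
have size_t: size t = (size p).+1 by rewrite def_t size_rcons.
have pre_zp: prefix z p by apply: (@prefix_rconsW _ z p b); rewrite -def_t // eq_sym.
have bl_zp: block k (size z) (size p).+1.
  by rewrite -size_t; apply: block_between bl_zw _ _; exact: size_prefix.
exists p, b, c, C'; split; last by left.
- by rewrite def_C def_h def_t.
- by [].
- have [l0 [lt_l0 le_l0 def_l0]] := block_tgt_asc bl_zp.
  rewrite def_C; apply: (@path_below z p l0); rewrite // -?/t ?def_t ?rcons_neq ?prefix_rcons //.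
    exact: leq_ltn_trans lt_l0.
  move=> zz c1 zz_C pre_zz lt_zz; rewrite -size_t => bl_zz.
  (* A block that starts between [z] and [t] and contains the depth of [t] has a level strictly
     between [j0] and [j1], already crossed. *)
  have [|||j [def_j lt_j gt_j]] :=
    @tgt_cross_up k (size w) j0 j1 (size zz) j0_gt0 j1_gt0 (block_trans bl_zz bl_tw).
  + by rewrite tgt_j0.
  + by rewrite tgt_j1 size_t ltnS size_prefix.
  + by rewrite tgt_j1 size_prefix.
  have [|u u_A [hu nu /eqP[]]] := ivt j.*2; first by rewrite hx hq between_double.
  apply: crossing zz_C (level_w u j zz nu hu _ _ def_j _) => //.
  + exact: leq_ltn_trans lt_j.
  + by apply: leq_trans (ltnW gt_j) _; rewrite geq_max le_j0.
  by apply: prefix_trans pre_zz (prefix_trans _ pre_tw); rewrite def_t prefix_rcons.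
by rewrite def_C.
Qed.

(** Within the subtree of [z], a hub leads to its partner, to a first connector, or to a level with
    target [z]. After a first connector the path cannot go on, and a level after the partner would
    also be adjacent to the first hub. So a path of more than three vertices goes straight to a
    level. *)
Lemma descend z c0 R : let P := (z, 0, c0) :: R in
    induced P -> all valid P -> all (fun v => prefix z (node v)) P ->
  exists A C, [/\ P = A ++ C, size A <= width.+1
    & C = [::] \/ descended P z C].
Proof.
move=> P indP vP preP.
have small: size P <= 3 -> exists A C, [/\ P = A ++ C, size A <= width.+1
    & C = [::] \/ descended P z C].
  move=> le_P; exists P, [::]; rewrite cats0; split=> //; last by left.
  by apply: leq_trans le_P _; rewrite /width; lia.
rewrite /P in indP vP preP small *.
case: R => [|x B] in P indP vP preP small *; first exact: small.
have [uP /= /andP[e_x pathB] cut] := indP.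
case lev_x: (level_of x z); first exact: descend_level.
case: B => [|x2 B] in P indP vP preP small uP pathB cut *; first exact: small.
have preR: all (fun v => prefix z (node v)) (x :: x2 :: B) by case/andP: preP.
case: (posnP (height x)) => [x_hub | x_gt0]; last first.
  case: (edge_hub_line x_gt0 e_x) => [nx hx sx | def_z _ _ | def_z _ | lev].
  - have def_x: x = (z, 1, c0) by case: (x) nx hx sx => [[t h] s]; rewrite /node /height /= => -> -> ->.
    rewrite def_x in indP; case: (@no_first_connector [:: (z, 0, c0)] z c0 x2 B) => //.
      exact: mem_head.
    by case/andP: preR.
  - by case/andP: preR => /size_prefix; rewrite def_z size_rcons ltnn.
  - by case/andP: preR => /size_prefix; rewrite def_z size_rcons ltnn.
  by rewrite lev in lev_x.
have def_x: x = (z, 0, x.2).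
  case: (x) x_hub e_x => [[t h] s]; rewrite /height /= => ->.
  by move/edge_hub_hub->.
case: B => [|x3 B] in P indP vP preP small uP pathB cut preR *; first exact: small.
case/andP: pathB => e_x2 /andP[e_x3 _].
have nonadj v : v \in x2 :: x3 :: B -> ~ edge (z, 0, c0) v.
  move=> v_B e_v; have [] := cut [:: (z, 0, c0)] (x :: x2 :: x3 :: B) _ v erefl _ _ e_v.
  - exact: mem_head.
  - by rewrite inE v_B orbT.
  by move=> _ /= eq_v; move: uP; rewrite /= -eq_v v_B andbF.
case: (posnP (height x2)) => [x2_hub | x2_gt0].
  move: uP; rewrite def_x; case: (x2) x2_hub e_x2 => [[t h] s]; rewrite /height /= => ->.
  rewrite def_x => /edge_hub_hub <-; rewrite /= !inE !negb_or !xpair_eqE !eqxx /=.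
  by case: (c0) (x.2) s => [] [] [] //=; rewrite ?andbF.
rewrite def_x in e_x2; case: (edge_hub_line x2_gt0 e_x2) => [nx hx sx | def_z _ _ | def_z _ | lev].
- have def_x2: x2 = (z, 1, x.2) by case: (x2) nx hx sx => [[t h] s]; rewrite /node /height /= => -> -> ->.
  rewrite def_x2 in indP; case: (@no_first_connector [:: (z, 0, c0); x] z x.2 x3 B) => //.
    by rewrite !inE -def_x eqxx orbT.
  by case/and3P: preR.
- by case/and3P: preR => _ /size_prefix; rewrite def_z size_rcons ltnn.
- by case/and3P: preR => _ /size_prefix; rewrite def_z size_rcons ltnn.
by case: (nonadj x2); rewrite ?mem_head // edge_sym edge_level.
Qed.

(** The path leaves the region [near p] through a hub [y] of a child [z] of [p]. From the subtree of
    [z], the ladder of [p] can be reached only through a hub of [z], and no such hub follows [y]. *)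
Lemma approach p x P : induced (x :: P) -> all (below p) (x :: P) -> near p x ->
  exists A C, [/\ x :: P = A ++ C, all (near p) A
    & C = [::] \/ exists b c R, C = (rcons p b, 0, c) :: R /\
        all (fun v => prefix (rcons p b) (node v)) C].
Proof.
move=> indP belowP near_x.
have [A [C [defP nearA outC]]] := split_all (near p) (x :: P).
case: outC => [C0 | [v [C' [defC not_near]]]].
  by exists A, C; split=> //; left.
case/lastP: A => [|A y] in nearA defP.
  by move: defP near_x; rewrite defC => -[-> _]; rewrite (negbTE not_near).
rewrite all_rcons in nearA; case/andP: nearA => near_y nearA.
have [uP sP cut] := indP.
have defP' : x :: P = A ++ y :: C by rewrite defP cat_rcons.
have [e_yv pathC]: edge y v /\ path edge v C'.
  by move: sP; rewrite defP' defC => /cat_sorted2[_ /= /andP].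
have below_all u : u \in y :: C -> below p u.
  by move=> u_C; apply: (allP belowP); rewrite defP' mem_cat u_C orbT.
have below_v: below p v by apply: below_all; rewrite defC !inE eqxx orbT.
have near_hub b u : hub_of (rcons p b) u -> near p u by case/hub_near_below/andP.
have [b hub_y]: exists b, hub_of (rcons p b) y.
  case/orP: near_y => [/andP[/eqP ny y_gt0] | /orP[]]; [ | by exists false | by exists true].
  case/andP: below_v => pre_pv not_hub; case: (posnP (height v)) => [v_hub | v_gt0].
    have def_v: v = (node v, 0, v.2) by rewrite -v_hub; case: (v) => [[]].
    have neq_v: node v != p by apply: contraNneq not_hub => nv; rewrite /hub_of nv v_hub !eqxx.
    have e_vy: edge (node v, 0, v.2) y by rewrite -def_v edge_sym.
    case: (edge_hub_line y_gt0 e_vy) => [nv _ _ | nv _ _ | nv _ | lev].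
    - by rewrite -nv ny eqxx in neq_v.
    - by case/negP: not_near; apply: (@near_hub v.2); rewrite /hub_of nv ny v_hub !eqxx.
    - by case/negP: not_near; apply: (@near_hub (~~ v.2)); rewrite /hub_of nv ny v_hub !eqxx.
    have [j [_ pre_vy]] := level_ofP lev; rewrite ny in pre_vy.
    by rewrite (prefix_size_eq pre_vy (size_prefix pre_pv)) eqxx in neq_v.
  case/negP: not_near; apply/orP; left; rewrite /line_of v_gt0 andbT.
  case: y v y_gt0 v_gt0 ny e_yv {A C defP defP' nearA defC pathC below_all not_hub pre_pv}
    => [[t1 h1] s1] [[t2 h2] s2] h1_gt0 h2_gt0 /= <- e_yv.
  by have [-> *] := edge_line_line h1_gt0 h2_gt0 e_yv.
have [c def_y] := hub_ofP hub_y.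
set z := rcons p b in hub_y def_y *.
(* The partner of [y] is adjacent to [y] without being the next vertex [v], which is not near
   [p]. *)
have no_hub u : u \in C -> ~~ hub_of z u.
  move=> u_C; apply/negP=> hub_u; have [c1 def_u] := hub_ofP hub_u.
  case: (eqVneq c1 c) => [eq_c | neq_c].
    move: uP; rewrite defP' cat_uniq => /and3P[_ _ /andP[/negP[]]].
    by rewrite def_y -eq_c -def_u.
  have e_yu: edge y u.
    rewrite def_y def_u; case: (c) (c1) neq_c => [] [] // _; rewrite ?edge_partner //.
    by rewrite edge_sym edge_partner.
  have [] := cut (rcons A y) C y u defP _ u_C e_yu; first by rewrite mem_rcons mem_head.
  rewrite defC /= => _ def_uv; case/negP: not_near; rewrite -def_uv.
  exact: near_hub hub_u.
have lt_pz (t : seq bool) : prefix z t -> size p < size t.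
  by move/size_prefix; rewrite size_rcons.
have pre_zv: prefix z (node v).
  case: (posnP (height v)) => [v_hub | v_gt0].
    have def_v: v = (node v, 0, v.2) by rewrite -v_hub; case: (v) => [[]].
    by rewrite def_y def_v in e_yv; rewrite (edge_hub_hub e_yv) prefix_refl.
  rewrite def_y in e_yv; case: (edge_hub_line v_gt0 e_yv) => [-> _ _ | nz _ _ | nz _ | lev].
  - exact: prefix_refl.
  - by case/negP: not_near; rewrite /near /line_of; case: (rcons_inj nz) => <- _; rewrite eqxx v_gt0.
  - by case/negP: not_near; rewrite /near /line_of; case: (rcons_inj nz) => <- _; rewrite eqxx v_gt0.
  by have [j []] := level_ofP lev.
exists A, (y :: C); split=> //; right; exists b, c, C; rewrite -/z -def_y; split=> //.
rewrite {1}def_y /= prefix_refl /= defC.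
apply: path_stay pathC pre_zv _ => u u' u_C u'_C pre_zu e_uu'.
case: (edge_comparable e_uu') => [| pre_u'u]; first exact: prefix_trans.
case: (leqP (size z) (size (node u'))) => [le_z | lt_z].
  exact: prefix_comparable pre_zu pre_u'u le_z.
have /andP[pre_pu' not_hub]: below p u'.
  by apply: below_all; rewrite inE defC inE u'_C !orbT.
have nu': p = node u'.
  by apply: prefix_size_eq pre_pu' _; rewrite -ltnS -(size_rcons p b).
have u'_gt0: 0 < height u'.
  by rewrite lt0n; apply: contra not_hub => hu'; rewrite /hub_of -nu' eqxx.
have neq_up: node u != p by apply: contraTneq (lt_pz _ pre_zu) => ->; rewrite ltnn.
(* The edge goes back to the ladder of [p], so it would have to start at a hub of [z]. *)
exfalso; case: (posnP (height u)) => [u_hub | u_gt0].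
  have def_u: u = (node u, 0, u.2) by rewrite -u_hub; case: (u) => [[]].
  have not_rcons b' : node u <> rcons p b'.
    move=> nu; have /no_hub/negP[]: u \in C by rewrite defC.
    rewrite /hub_of u_hub andbT eq_sym; apply/eqP; apply: (prefix_size_eq pre_zu).
    by rewrite nu !size_rcons.
  rewrite def_u in e_uu'; case: (edge_hub_line u'_gt0 e_uu') => [nu _ _ | nu _ _ | nu _ | lev].
  - by rewrite -nu -nu' eqxx in neq_up.
  - by apply: (not_rcons u.2); rewrite nu'.
  - by apply: (not_rcons (~~ u.2)); rewrite nu'.
  have [j [_ /size_prefix]] := level_ofP lev.
  by rewrite -nu' leqNgt lt_pz.
case: u u' u_gt0 u'_gt0 neq_up nu' e_uu' {u_C u'_C pre_zu pre_u'u lt_z pre_pu' not_hub}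
  => [[t1 h1] s1] [[t2 h2] s2] h1_gt0 h2_gt0 neq_up nu' e_uu'.
have [eq_t _ _ _ _] := edge_line_line h1_gt0 h2_gt0 e_uu'.
by rewrite nu' /node /= eq_t eqxx in neq_up.
Qed.

(** * Counting the rounds *)

(** One round is an [approach], of at most [width] vertices, and a [descend], of at most
    [width.+1]. *)
Definition step_cost : nat := width.*2.+1.

Lemma near_child p b c : near p (rcons p b, 0, c).
Proof.
by have /hub_near_below/andP[]: hub_of (rcons p b) (rcons p b, 0, c)
  by rewrite /hub_of !eqxx.
Qed.

Lemma approach_descend p x P : induced (x :: P) -> all valid (x :: P) ->
    all (below p) (x :: P) -> near p x ->
  size (x :: P) <= step_cost \/
  exists A b C, [/\ x :: P = A ++ C, size A <= step_cost,
    size (rcons p b) < 2 ^ k & descended (x :: P) (rcons p b) C].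
Proof.
move=> indP vP belowP near_x.
have [A [C [defP nearA outC]]] := approach indP belowP near_x.
have le_A: size A <= width.
  have [uP _ _] := indP; apply: (@size_near p) => //.
    by move: uP; rewrite defP cat_uniq => /and3P[].
  by move: vP; rewrite defP all_cat => /andP[].
case: outC => [C0 | [b [c [R [defC preC]]]]].
  left; rewrite defP C0 cats0; apply: leq_trans le_A _.
  by rewrite /step_cost -addnn -addnS leq_addr.
have indC: induced C by apply: (@induced_suffix A); rewrite -defP.
have vC: all valid C by move: vP; rewrite defP all_cat => /andP[].
rewrite defC in indC vC preC.
have [A' [C' [defR le_A' outC']]] := descend indC vC preC.
have le_AA: size (A ++ A') <= step_cost.
  by rewrite size_cat /step_cost -addnn -addnS leq_add.
have defP': x :: P = (A ++ A') ++ C' by rewrite defP defC defR catA.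
case: outC' => [C'0 | desc]; first by left; rewrite defP' C'0 cats0.
right; exists (A ++ A'), b, C'; split=> //; first by case/andP: vC => /andP[].
case: desc => p' [b' [c' [C1 [defC' pre_z belowC' nlev st]]]].
exists p', b', c', C1; split=> //; case: st => [|[bl nbl lev]]; [by left | right].
split=> // y bl_y lt_y; have [v v_R lev_v] := lev y bl_y lt_y.
by exists v; rewrite // defP mem_cat defC v_R orbT.
Qed.

(* Here [P] cannot leave the block of [z], so the blocks it visits shrink. *)
Lemma size_sealed n p z x P : logn 2 (size p).+1 < n ->
    induced (x :: P) -> all valid (x :: P) -> all (below p) (x :: P) -> near p x ->
    prefix z p -> block k (size z) (size p).+1 ->
    {in x :: P, forall v, ~~ level_of v z} ->
  size (x :: P) <= n * step_cost.
Proof.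
elim: n p z x P => // n IHn p z x P lt_n indP vP belowP near_x pre_zp bl_z nlev.
case: (approach_descend indP vP belowP near_x) => [le_P | [A [b [C [defP le_A lt_pb desc]]]]].
  by rewrite mulSn; apply: leq_trans le_P (leq_addr _ _).
rewrite defP size_cat mulSn leq_add //.
case: desc => p' [b' [c' [C' [defC pre_p' belowC nlevC st]]]].
have near_C := near_child p' b' c'.
have lt_p': size p < size p' by rewrite -(size_rcons p b) size_prefix.
(* Leaving the block of [rcons p b] at its bottom would meet a level for the larger block of [z],
   against [nlev]. *)
case: st => [bl | [bl _ lev]]; last first.
  have lt_z: size z < size (rcons p b) by rewrite size_rcons ltnS size_prefix.
  rewrite size_rcons in bl; have [v v_P] := lev _ (block_trans bl_z bl) lt_z.
  have pre_zp': prefix z p'.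
    exact: prefix_trans pre_zp (prefix_trans (prefix_rcons p b) pre_p').
  by move: pre_zp'; rewrite prefixE => /eqP-> lev_v; case/negP: (nlev v v_P).
rewrite defC in belowC nlevC *; apply: (IHn p' (rcons p b)) => //.
- rewrite -ltnS; apply: leq_trans lt_n; rewrite ltnS -(size_rcons p b).
  by apply: block_lognS bl _; rewrite ?size_rcons // ltnS.
- by apply: (@induced_suffix A); rewrite -defC -defP.
by move: vP; rewrite defP all_cat defC => /andP[].
Qed.

(* As long as [P] leaves each block at its bottom, the blocks grow. *)
Lemma size_unsealed m p x P : k <= logn 2 (size p).+1 + m ->
    induced (x :: P) -> all valid (x :: P) -> all (below p) (x :: P) -> near p x ->
  size (x :: P) <= (m + k).+1 * step_cost.
Proof.
elim: m p x P => [|m IHm] p x P le_k indP vP belowP near_x.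
all: have lt_k b : size (rcons p b) < 2 ^ k -> logn 2 (size p).+1 < k.
all: try by rewrite size_rcons => lt_p; rewrite -(@ltn_exp2l 2) //;
  apply: leq_ltn_trans lt_p; apply: dvdn_leq; rewrite ?pfactor_dvdnn.
all: case: (approach_descend indP vP belowP near_x) => [le_P | [A [b [C [defP le_A lt_pb desc]]]]].
all: try by rewrite mulSn; apply: leq_trans le_P (leq_addr _ _).
  (* For [m = 0] the depth of a child has valuation at least [k], but depths are below [2 ^ k]. *)
  by move: (lt_k b lt_pb); rewrite ltnNge -[logn _ _]addn0 le_k.
rewrite defP size_cat mulSn leq_add // addSn.
case: desc => p' [b' [c' [C' [defC pre_p' belowC nlevC st]]]].
have near_C := near_child p' b' c'.
have lt_p': size p < size p' by rewrite -(size_rcons p b) size_prefix.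
have indC: induced C by apply: (@induced_suffix A); rewrite -defP.
have vC: all valid C by move: vP; rewrite defP all_cat => /andP[].
rewrite defC in belowC nlevC indC vC *.
(* Either the block reaches past [p'] and the path is sealed from here on, or the valuation has
   grown and [m] decreases. *)
case: st => [bl | [bl nbl _]].
  apply: leq_trans (_ : k * step_cost <= _); last by rewrite leq_mul2r leqW ?leq_addl ?orbT.
  apply: (@size_sealed k p' (rcons p b)) => //.
  apply: leq_trans (lt_k b lt_pb); rewrite ltnS -(size_rcons p b); apply: ltnW.
  by apply: block_lognS bl _; rewrite ?size_rcons // ltnS.
apply: (IHm p') => //; apply: leq_trans le_k _; rewrite addnS -addSn leq_add2r.
rewrite -(size_rcons p b); apply: block_logn_next bl nbl _; rewrite ?size_rcons //.
by case/andP: vC => /andP[]; rewrite size_rcons.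
Qed.

Lemma size_arm z c R : induced ((z, 0, c) :: R) -> all valid ((z, 0, c) :: R) ->
    all (fun v => prefix z (node v)) ((z, 0, c) :: R) ->
  size ((z, 0, c) :: R) <= k.+1.*2 * step_cost.
Proof.
move=> indP vP preP; have [A [C [defP le_A outC]]] := descend indP vP preP.
have {}le_A: size A <= step_cost.
  by apply: leq_trans le_A _; rewrite /step_cost ltnS -addnn leq_addr.
rewrite defP size_cat doubleS mulSn leq_add //.
case: outC => [-> // | desc].
case: desc => p' [b' [c' [C' [defC pre_p' belowC nlevC st]]]].
have near_C := near_child p' b' c'.
rewrite -addnn defC; apply: (@size_unsealed k p').
- by rewrite leq_addl.
- by rewrite -defC; apply: (@induced_suffix A); rewrite -defP.
- by move: vP; rewrite defP all_cat -defC => /andP[].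
- by rewrite -defC.
by [].
Qed.

(** Edges join comparable nodes, so the path stays in the subtree of its topmost node [q]. Split at
    a hub of [q] if there is one, else at a vertex of the ladder of [q], it falls into two arms that
    each go down. *)
Lemma size_induced Q : induced Q -> all valid Q ->
  size Q <= k.+1.*2.*2 * step_cost.
Proof.
move=> indQ vQ; case: (posnP (size Q)) => [-> // | Q_gt0].
have [n] : exists n, has (fun u => size (node u) == n) Q.
  by case: (Q) Q_gt0 => // u Q' _; exists (size (node u)); rewrite /= eqxx.
move=> ex_n; have ex_n' : exists n, has (fun u => size (node u) == n) Q by exists n.
case: (ex_minnP ex_n') => m /hasP[v v_Q /eqP def_m] min_m {n ex_n ex_n'}.
have min_v u : u \in Q -> size (node v) <= size (node u).
  by move=> u_Q; rewrite def_m; apply: min_m; apply/hasP; exists u.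
set q := node v in def_m min_v.
have stay u u' : u' \in Q -> prefix q (node u) -> edge u u' -> prefix q (node u').
  move=> u'_Q pre_u /edge_comparable[|pre_u']; first exact: prefix_trans.
  by apply: prefix_comparable pre_u pre_u' _; exact: min_v.
have split u : u \in Q -> exists Q1 Q2, [/\ Q = Q1 ++ u :: Q2, induced (u :: Q2),
    induced (u :: rev Q1), {subset u :: Q2 <= Q} & {subset u :: rev Q1 <= Q}].
  move=> u_Q; have [Q1 [Q2 defQ]]: exists Q1 Q2, Q = Q1 ++ u :: Q2.
    by case/splitPr: u_Q => Q1 Q2; exists Q1, Q2.
  exists Q1, Q2; split=> //.
  - by apply: (@induced_suffix Q1); rewrite -defQ.
  - apply: (@induced_suffix (rev Q2)).
    by rewrite -cat_rcons -rev_cons -rev_cat -defQ; apply: induced_rev.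
  - by move=> w w_R; rewrite defQ mem_cat w_R orbT.
  by move=> w; rewrite inE mem_rev defQ mem_cat inE => /orP[] ->; rewrite ?orbT.
have preQ: all (fun u => prefix q (node u)) Q.
  have [Q1 [Q2 [defQ [_ /= path2 _] [_ /= path1 _] sub2 sub1]]] := split v v_Q.
  have stay_path R : path edge v R -> {subset v :: R <= Q} ->
      {in v :: R, forall u, prefix q (node u)}.
    move=> pathR subR; apply/allP; apply: path_stay pathR _ _; first exact: prefix_refl.
    by move=> u u' _ u'_R; apply: stay; apply: subR; rewrite inE u'_R orbT.
  apply/allP=> u; rewrite defQ mem_cat => /orP[u_1 | u_2].
    by apply: stay_path path1 sub1 _ _; rewrite inE mem_rev u_1 orbT.
  exact: stay_path path2 sub2 _ u_2.
have bound u Q1 Q2 : Q = Q1 ++ u :: Q2 -> size (u :: Q2) <= k.+1.*2 * step_cost ->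
    size (u :: rev Q1) <= k.+1.*2 * step_cost -> size Q <= k.+1.*2.*2 * step_cost.
  move=> -> le2; rewrite /= size_rev => le1.
  rewrite size_cat -[in leqRHS]addnn mulnDl leq_add //; exact: ltnW.
have sub_all_Q (a : pred vert) R : {subset R <= Q} -> all a Q -> all a R.
  by move=> subR /allP aQ; apply/allP=> u /subR/aQ.
case hubQ: (has (hub_of q) Q).
  have [u u_Q /hub_ofP[c def_u]] := hasP hubQ.
  have [Q1 [Q2 [defQ ind2 ind1 sub2 sub1]]] := split u u_Q.
  by apply: (bound u Q1 Q2 defQ); rewrite def_u in ind1 ind2 sub1 sub2 *;
    apply: size_arm; rewrite // (sub_all_Q _ _ _ vQ, sub_all_Q _ _ _ preQ).
have belowQ: all (below q) Q.
  apply/allP=> u u_Q; rewrite /below (allP preQ) //=; apply: contraFN hubQ => hub_u.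
  by apply/hasP; exists u.
have near_v: near q v.
  rewrite /near /line_of eqxx lt0n; apply/orP; left; move: (allP belowQ v v_Q).
  by rewrite /below /hub_of eqxx => /andP[].
have [Q1 [Q2 [defQ ind2 ind1 sub2 sub1]]] := split v v_Q.
have le_c: (k + k).+1 * step_cost <= k.+1.*2 * step_cost.
  by rewrite addnn leq_mul2r doubleS leqnSn orbT.
by apply: (bound v Q1 Q2 defQ); apply: leq_trans le_c;
  apply: (size_unsealed (p := q)); rewrite ?leq_addl //; apply: sub_all_Q.
Qed.

(** * The depth-first walk *)

Fixpoint ham (n : nat) (t : seq bool) : seq vert :=
  if n is m.+1 then
    [seq (t, h, false) | h <- iota 0 top.+1] ++ ham m (rcons t false) ++
    (t, top.+1, false) :: ham m (rcons t true) ++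
    [seq (t, top - h, true) | h <- iota 0 top.+1]
  else [:: (t, 0, false); (t, 0, true)].

Lemma hamS n t : ham n.+1 t =
  [seq (t, h, false) | h <- iota 0 top.+1] ++ ham n (rcons t false) ++
  (t, top.+1, false) :: ham n (rcons t true) ++
  [seq (t, top - h, true) | h <- iota 0 top.+1].
Proof. by []. Qed.

Lemma path_map_iota (T : Type) (e : rel T) (f : nat -> T) a m :
    (forall h, a <= h < a + m -> e (f h) (f h.+1)) ->
  path e (f a) [seq f h | h <- iota a.+1 m].
Proof.
elim: m a => //= m IHm a step; apply/andP; split.
  by apply: step; rewrite leqnn addnS ltnS leq_addr.
by apply: IHm => h /andP[le_h lt_h]; apply: step; rewrite (ltnW le_h) addnS -addSn.
Qed.

Lemma last_map_iota (T : Type) (f : nat -> T) a m :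
  last (f a) [seq f h | h <- iota a.+1 m] = f (a + m).
Proof. by elim: m a => /= [|m IHm] a; rewrite ?addn0 // IHm addSn addnS. Qed.

Lemma edge_line_succ t h s : h < top -> edge (t, h, s) (t, h.+1, s).
Proof.
move=> lt_h; rewrite /edge; case: (posnP h) => [-> | h_gt0].
  by apply/orP; right; rewrite /= /top /= inE eqxx.
case odd_h: (odd h).
  by apply/orP; left; rewrite /= gtn_eqF // lt_h odd_h !inE eqxx orbT.
apply/orP; right; rewrite /= odd_h /=; case: (ltngtP h.+1 top) => [_|gt_h|_].
- by rewrite inE eqxx.
- by rewrite ltnNge lt_h in gt_h.
by rewrite inE eqxx.
Qed.

Lemma edge_to_child t s : edge (t, top, s) (rcons t s, 0, s).
Proof. by rewrite /edge /= ltnn eqxx !inE eqxx orbT. Qed.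

Lemma edge_to_sibling t s : edge (t, top.+1, false) (rcons t s, 0, ~~ s).
Proof.
rewrite /edge /= ltnNge leqnSn /= gtn_eqF // !inE.
by case: s; rewrite eqxx ?orbT.
Qed.

(** The vertex [x] before the walk is a parameter so that the induction can glue the walks of the
    two subtrees. *)
Lemma ham_path n t x : edge x (t, 0, false) ->
  path edge x (ham n t) /\ last x (ham n t) = (t, 0, true).
Proof.
elim: n t x => [|n IHn] t x e_x.
  by rewrite /= e_x edge_sym edge_partner.
have [U [defU path_U last_U]]: exists U,
  [/\ [seq ((t, h, false) : vert) | h <- iota 0 top.+1] = (t, 0, false) :: U,
      path edge (t, 0, false) U & last (t, 0, false) U = (t, top, false)].
  pose f h : vert := (t, h, false); exists [seq f h | h <- iota 1 top]; split=> //.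
    by apply: (@path_map_iota _ _ f) => h /andP[_]; exact: edge_line_succ.
  exact: (last_map_iota f).
have [D [defD path_D last_D]]: exists D,
  [/\ [seq ((t, top - h, true) : vert) | h <- iota 0 top.+1] = (t, top, true) :: D,
      path edge (t, top, true) D & last (t, top, true) D = (t, 0, true)].
  pose f h : vert := (t, top - h, true); exists [seq f h | h <- iota 1 top].
  rewrite -[top in (t, top, true)]subn0 -/(f 0); split=> //.
    apply: path_map_iota => h /andP[_ lt_h]; rewrite edge_sym /f subnS.
    by rewrite -{2}[top - h]prednK ?subn_gt0 //; apply: edge_line_succ;
      rewrite prednK ?subn_gt0 // leq_subr.
  by rewrite (last_map_iota f) /f subnn.
have [path0 last0] := IHn (rcons t false) (t, top, false) (edge_to_child t false).
have [path1 last1] := IHn (rcons t true) (t, top.+1, false) (edge_to_sibling t true).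
rewrite hamS defU defD !(cat_path, last_cat) /= !(cat_path, last_cat) /=.
rewrite last_U last0 last1 last_D e_x path_U path0 path1 path_D.
by rewrite edge_sym (edge_to_sibling t false) edge_sym edge_to_child.
Qed.

Lemma mem_cat_around (T : eqType) (x v : T) s1 s2 s3 s4 :
  (v \in s1 ++ s2 ++ x :: s3 ++ s4)
  = [|| v \in s1, v \in s2, v == x, v \in s3 | v \in s4].
Proof. by rewrite !(mem_cat, inE). Qed.

Lemma uniq_cat_around (T : eqType) (x : T) s1 s2 s3 s4 :
    [/\ uniq s1, uniq s2, uniq s3 & uniq s4] ->
    {in s1, forall v, [&& v \notin s2, v != x, v \notin s3 & v \notin s4]} ->
    {in s2, forall v, [&& v != x, v \notin s3 & v \notin s4]} ->
    x \notin s3 -> x \notin s4 -> {in s3, forall v, v \notin s4} ->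
  uniq (s1 ++ s2 ++ x :: s3 ++ s4).
Proof.
case=> u1 u2 u3 u4 d1 d2 x3 x4 d3.
have u34: uniq (s3 ++ s4).
  by rewrite cat_uniq u3 u4 andbT; apply/hasPn=> v; apply: contraTN => /d3.
have u234: uniq (s2 ++ x :: s3 ++ s4).
  rewrite cat_uniq u2 cons_uniq u34 mem_cat negb_or x3 x4 !andbT.
  apply/hasPn=> v; rewrite inE mem_cat; apply: contraTN => /d2.
  by rewrite !negb_or.
rewrite cat_uniq u1 u234 andbT; apply/hasPn=> v; apply: contraTN => /d1.
by rewrite mem_cat inE mem_cat !negb_or.
Qed.

Lemma mem_ham n t v : v \in ham n t ->
  [/\ prefix t (node v), size (node v) <= size t + n & height v <= top.+1].
Proof.
elim: n t => [|n IHn] t.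
  by rewrite !inE => /orP[] /eqP->; rewrite /node /height /= prefix_refl addn0.
have child b : v \in ham n (rcons t b) ->
    [/\ prefix t (node v), size (node v) <= size t + n.+1 & height v <= top.+1].
  case/IHn; rewrite size_rcons addSnnS => pre_v le_v le_h; split=> //.
  exact: prefix_trans (prefix_rcons t b) pre_v.
rewrite hamS mem_cat_around.
case/or4P=> [/mapP[h h_i ->] | /child // | /eqP-> | /orP[/child // |]].
- rewrite /node /height /= prefix_refl leq_addr; split=> //.
  by rewrite mem_iota in h_i; apply: ltnW; case/andP: h_i.
- by rewrite /node /height /= prefix_refl leq_addr leqnn.
case/mapP=> h _ ->; rewrite /node /height /= prefix_refl leq_addr; split=> //.
exact: leq_trans (leq_subr _ _) (leqnSn _).
Qed.

Lemma uniq_ham n t : uniq (ham n t).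
Proof.
elim: n t => [|n IHn] t; first by rewrite /= inE xpair_eqE andbF.
have child b v : v \in ham n (rcons t b) -> node v != t.
  case/mem_ham=> /size_prefix lt_t _ _; rewrite size_rcons in lt_t.
  by apply: contraTneq lt_t => ->; rewrite ltnn.
have sibling v : v \in ham n (rcons t false) -> v \notin ham n (rcons t true).
  case/mem_ham=> pre0 _ _; apply/negP=> /mem_ham[pre1 _ _].
  have: prefix (rcons t false) (rcons t true).
    by apply: prefix_comparable pre0 pre1 _; rewrite !size_rcons.
  by move/prefix_size_eq; rewrite !size_rcons leqnn => /(_ isT)/rcons_inj.
have uniq_up: uniq [seq ((t, h, false) : vert) | h <- iota 0 top.+1].
  by rewrite map_inj_uniq ?iota_uniq // => h1 h2 [].
have uniq_down: uniq [seq ((t, top - h, true) : vert) | h <- iota 0 top.+1].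
  rewrite map_inj_in_uniq ?iota_uniq // => h1 h2.
  rewrite !mem_iota !add0n !ltnS /= => le1 le2 [/(congr1 (subn top))].
  by rewrite !subKn.
rewrite hamS; apply: uniq_cat_around; first by split.
- move=> _ /mapP[h h_i ->]; apply/and4P; split.
  + by apply/negP=> /child; rewrite /node /= eqxx.
  + by apply/eqP=> -[def_h]; rewrite mem_iota def_h add0n ltnn in h_i.
  + by apply/negP=> /child; rewrite /node /= eqxx.
  by apply/mapP=> -[].
- move=> v v_0; have neq_v := child _ _ v_0; apply/and3P; split.
  + by apply: contraNneq neq_v => ->.
  + exact: sibling.
  by apply: contra neq_v => /mapP[h _ ->].
- by apply/negP=> /child; rewrite /node /= eqxx.
- by apply/mapP=> -[].
by move=> v /child; apply: contra => /mapP[h _ ->].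
Qed.

Lemma size_ham n t : 2 ^ n.+1 <= size (ham n t).
Proof.
elim: n t => // n IHn t; rewrite hamS !size_cat /= size_cat expnS mul2n -addnn.
apply: leq_trans (leq_add (IHn (rcons t false)) (IHn (rcons t true))) _.
apply: leq_trans (leq_addl _ _); rewrite leq_add2l; exact: leqW (leq_addr _ _).
Qed.

End Construction.

(** * The finite graph *)

Definition ham_seq (k : nat) : seq vert := ham k (2 ^ k).-1 [::].

(** Only the vertices of the walk are kept, so the walk is Hamiltonian by construction. *)
Definition ham_edge (k : nat) : rel (seq_sub (ham_seq k)) :=
  fun x y => edge k (val x) (val y).

Lemma ham_edge_sym k : symmetric (@ham_edge k).
Proof. by move=> x y; exact: edge_sym. Qed.

Lemma ham_edge_irrefl k : irreflexive (@ham_edge k).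
Proof. by move=> x; exact: edge_irrefl. Qed.

Definition ham_graph (k : nat) : sgraph :=
  SGraph (@ham_edge_sym k) (@ham_edge_irrefl k).

(** In a subgraph, the neighbours of a vertex of maximal [rank] all lie in its [down] list. *)
Lemma degenerate_ham_graph k : degenerate 2 (ham_graph k).
Proof.
move=> H /set0Pn[x0 x0_H]; case: (arg_maxnP (fun x : ham_graph k => rank k (val x)) x0_H).
move=> x x_H max_x; exists x => //; rewrite /sub_degree cardE -(size_map val).
apply: leq_trans (size_down k (val x)); apply: uniq_leq_size.
  by rewrite map_inj_uniq ?enum_uniq //; exact: val_inj.
move=> _ /mapP[y y_H ->]; rewrite mem_enum inE in y_H.
have [_ y_V /orP[] //] := sub_adjP y_H.
by move/rank_down; rewrite ltnNge => /negP[]; exact: max_x.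
Qed.

Lemma has_path_ham_graph k : has_path (ham_graph k) (size (ham_seq k)).
Proof.
pose p : seq (ham_graph k) := pmap insub (ham_seq k).
have def_p: map val p = ham_seq k.
  rewrite /p (pmap_filter (@insubK _ _ _)); apply/all_filterP/allP => v v_in.
  by rewrite /= isSome_insub.
exists p; last by rewrite -def_p size_map.
apply/andP; split; first by have := uniq_ham k (2 ^ k).-1 [::]; rewrite -/(ham_seq k) -def_p => /map_uniq.
have: sorted (edge k) (map val p).
  by rewrite def_p; have [/path_sorted] := ham_path (2 ^ k).-1 (edge_partner k [::]).
by rewrite sorted_map.
Qed.

Lemma induced_map_val k (p : seq (ham_graph k)) :
  is_induced_path p -> induced k (map val p).
Proof.
case=> /andP[uniq_p sorted_p] ind_p.
have uniq_vp: uniq (map val p) by rewrite map_inj_uniq //; exact: val_inj.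
split=> //; first by rewrite sorted_map.
move=> A B x y def_p x_A y_B e_xy.
have /mapP[x' x'_p def_x]: x \in map val p by rewrite def_p mem_cat x_A.
have /mapP[y' y'_p def_y]: y \in map val p by rewrite def_p mem_cat y_B orbT.
have y_A: y \notin A.
  by move: uniq_vp; rewrite def_p cat_uniq => /and3P[_ /hasPn/(_ y y_B)].
have idx_x: index x' p = index x A.
  by rewrite -(index_map val_inj) -def_x def_p index_cat x_A.
have idx_y: index y' p = size A + index y B.
  by rewrite -(index_map val_inj) -def_y def_p index_cat (negbTE y_A).
have lt_x: index x A < size A by rewrite index_mem.
have: consecutive p x' y'.
  by apply: ind_p => //; rewrite /= /ham_edge -def_x -def_y.
rewrite /consecutive idx_x idx_y => /orP[] /eqP idx; last by lia.
have [def_ix def_iy]: index x A = (size A).-1 /\ index y B = 0 by lia.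
split; first by rewrite -{1}(nth_index x x_A) def_ix nth_last.
by rewrite -{1}(nth_index y y_B) def_iy nth0.
Qed.

Lemma size_induced_ham_graph k (p : seq (ham_graph k)) : 0 < k ->
  is_induced_path p -> size p <= 400 * k ^ 2.
Proof.
move=> k_gt0 /induced_map_val/size_induced.
rewrite size_map => /(_ _)/leq_trans-> //; last first.
  (* The bound is [4 (k + 1) (16 k + 33)], at most [392 k ^ 2] for positive [k]. *)
  rewrite /step_cost /width /top; nia.
apply/allP=> _ /mapP[v _ ->]; have [_ le_v le_h] := mem_ham (valP v).
by rewrite /valid le_h andbT (leq_ltn_trans le_v) // prednK ?expn_gt0.
Qed.

Lemma size_ham_seq k : 2 ^ (2 ^ k) <= size (ham_seq k).
Proof. by rewrite -{1}[2 ^ k]prednK ?expn_gt0 //; exact: size_ham. Qed.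

(** * Iterated logarithms and the conclusion *)

Section LogLog.

Import Order.TTheory GRing.Theory Num.Theory.
Local Open Scope ring_scope.

Lemma ler_log2 (R : realType) (m : nat) (x : R) :
  (2 ^ m)%N%:R <= x -> m%:R <= log2 x.
Proof.
move=> le_x; have ln2_gt0: 0 < ln (2 : R) by rewrite ln_gt0 // ltr1n.
have pow_gt0: 0 < (2 ^ m)%N%:R :> R by rewrite ltr0n expn_gt0.
rewrite /log2 ler_pdivlMr // mulr_natl -lnXn // -natrX ler_ln //.
by rewrite posrE; exact: lt_le_trans le_x.
Qed.

Lemma ler_log2_log2 (R : realType) (m n : nat) :
  (2 ^ (2 ^ m) <= n)%N -> m%:R <= log2 (log2 (n%:R : R)).
Proof. by move=> le_n; do 2!apply: ler_log2; rewrite ler_nat. Qed.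

End LogLog.

Theorem theorem1p7 (R : realType) :
  exists c : R,
    infinite_set [set n : nat | exists G : sgraph,
      [/\ degenerate 2 G,
          has_path G n &
          forall p : seq G, is_induced_path p ->
            ((size p)%:R <= c * (log2 (log2 (n%:R : R))) ^+ 2)%R]]%classic.
Proof.
exists 400%:R%R => /finite_seqP[s def_s].
(* If the set were a finite list [s], this [k] would exceed all its entries, while the order of the
   walk, at least [2 ^ 2 ^ k], is larger still. *)
pose k := (\max_(i <- s) i).+1.
have: size (ham_seq k) \in s.
  suff: [set` s]%classic (size (ham_seq k)) by [].
  rewrite -def_s; exists (ham_graph k); split.
  - exact: degenerate_ham_graph.
  - exact: has_path_ham_graph.
  move=> p /size_induced_ham_graph-/(_ isT) le_p.
  have le_k := ler_log2_log2 R (size_ham_seq k).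
  apply: (@Order.POrderTheory.le_trans _ _ (400 * k ^ 2)%N%:R%R).
    by rewrite Num.Theory.ler_nat.
  rewrite GRing.natrM GRing.natrX Num.Theory.ler_wpM2l ?Num.Theory.ler0n //.
  by rewrite Num.Theory.lerXn2r ?Num.Theory.nnegrE ?Num.Theory.ler0n //;
    apply: Order.POrderTheory.le_trans le_k; rewrite Num.Theory.ler0n.
move/(@leq_bigmax_seq _ s xpredT id _)/(_ isT); rewrite leqNgt => /negP[].
apply: leq_trans (size_ham_seq k); apply: ltnW.
exact: ltn_trans (ltn_expl k (isT : 1 < 2)) (ltn_expl (2 ^ k) (isT : 1 < 2)).
Qed.
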